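(* Let $\mathbf{V}_{\mathsf{hypo}}$ be the monoid variety generated by the hypoplactic monoid $\mathsf{hypo}$. The basis rank of $\mathbf{V}_{\mathsf{hypo}}$ is $2$.
   Context: Let $\mathcal{A} = \{1<2<3<\cdots\}$ be the ordered alphabet of positive integers and $\mathcal{A}_n = \{1<\cdots<n\}$. For a word $w$, $|w|_a$ is the number of occurrences of the letter $a$; the content of $w$ is the tuple $(|w|_a)_a$, and the support $\mathrm{supp}(w)$ is the set of letters occurring in $w$. A quasi-ribbon tableau is a finite grid of cells, aligned so that the leftmost cell in each row is below the rightmost cell of the previous row, filled with letters of $\mathcal{A}$ so that rows weakly increase from left to right and columns strictly increase from top to bottom. Krob--Thibon insertion of a letter $a$ into a quasi-ribbon tableau $T$: if no entry of $T$ is $\le a$, create a new cell $a$ and glue $T$ by its top-leftmost entry to the bottom of this cell; otherwise, let $x$ be the right-most and bottom-most entry of $T$ with $x \le a$, separate $T$ just after $x$, put a new entry $a$ to the right of $x$ and glue the remaining part of $T$ (below and to the right of $x$) onto the bottom of the new entry $a$. For $u \in \mathcal{A}^*$, $\mathrm{P}_{\mathsf{hypo}}(u)$ is the tableau obtained from the empty tableau by inserting the letters of $u$ from left to right. The hypoplactic congruence is: $u \equiv_{\mathsf{hypo}} v$ iff $\mathrm{P}_{\mathsf{hypo}}(u) = \mathrm{P}_{\mathsf{hypo}}(v)$. The hypoplactic monoid is $\mathsf{hypo} = \mathcal{A}^*/{\equiv_{\mathsf{hypo}}}$, and the hypoplactic monoid of rank $n$ is $\mathsf{hypo}_n = \mathcal{A}_n^*/{\equiv_{\mathsf{hypo}}}$.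 Known equivalent description (Novelli): $u \equiv_{\mathsf{hypo}} v$ iff $u$ and $v$ have the same content and the same inversions, where, if $\mathrm{supp}(u) = \{a_1<\dots<a_k\}$, $u$ has an $a_{i+1}$-$a_i$ inversion ($1 \le i \le k-1$) iff $a_{i+1}a_i$ is a (scattered) subsequence of $u$. A monoid variety is a class of monoids closed under homomorphic images, submonoids and direct products; the variety generated by a monoid $M$ is the smallest variety containing $M$. The variety $\mathbf{V}_{\mathsf{hypo}}$ is also generated by $\mathsf{hypo}_n$ for each $n \ge 2$. The basis rank of a variety $\mathbf{V}$ is the least natural number $r$ such that $\mathbf{V}$ is generated by the $\mathbf{V}$-free monoid over an alphabet with $r$ letters (when such $r$ exists); if $\mathbf{V}$ is generated by some finitely generated monoid, it equals the minimal number of generators of a monoid generating $\mathbf{V}$. *)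

(* Defs.v *)
From HB Require Import structures.
From mathcomp Require Import all_boot all_order boolp.

Set Implicit Arguments.
Unset Strict Implicit.
Unset Printing Implicit Defensive.

Import Order.TTheory.

Local Open Scope order_scope.

Section Tableaux.
Context {d : Order.disp_t} {A : orderType d}.
Implicit Types (a x y z : A) (r s u v w : seq A) (T : seq (seq A)).

(* A quasi-ribbon tableau is the list of its rows, from top to bottom. Since the
   leftmost cell of each row lies below the rightmost cell of the previous one,
   the rows determine the shape, and columns increase strictly iff the last entry
   of each row is smaller than the first entry of the next row. *)
Definition row_above r s : bool :=
  if (r, s) is (x :: r', y :: _) then last x r' < y else false.

Definition quasi_ribbon T : bool :=
  all (fun r => ~~ nilp r && sorted <=%O r) T && sorted row_above T.

(* Krob-Thibon insertion. As rows are weakly increasing, the two filters cut the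
   row just after its rightmost entry [x <= a]. *)
Fixpoint kt_insert T a : seq (seq A) :=
  if T is r :: T' then
    if has (has (fun y => y <= a)) T' then r :: kt_insert T' a
    else if has (fun y => y <= a) r then
      let r1 := [seq y <- r | y <= a] in
      let r2 := [seq y <- r | a < y] in
      rcons r1 a :: (if nilp r2 then T' else r2 :: T')
    else [:: a] :: r :: T'
  else [:: [:: a]].

Definition P_hypo u : seq (seq A) := foldl kt_insert [::] u.

Definition hypo_eq u v : bool := P_hypo u == P_hypo v.

(* [hypo_eq] is a congruence. By Novelli's description, [P_hypo u] is obtained
   from the sorted rearrangement of [u] by starting a new row between [x] and [y]
   whenever [y x] is a subsequence of [u]. *)

Definition inversion u x y := (x < y) && subseq [:: y; x] u.

Definition push x T := if T is r :: T' then (x :: r) :: T' else [:: [:: x]].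

Fixpoint cut (p : A -> A -> bool) s :=
  if s is x :: s' then
    if s' is y :: _ then
      if p x y then [:: x] :: cut p s' else push x (cut p s')
    else [:: [:: x]]
  else [::].

Lemma flatten_push x T : flatten (push x T) = x :: flatten T.
Proof. by case: T. Qed.

Lemma cut_flatten p s : flatten (cut p s) = s.
Proof.
elim: s => [//|x [//|y s] IH].
change (flatten (if p x y then [:: x] :: cut p (y :: s)
                 else push x (cut p (y :: s))) = x :: y :: s).
by case: (p x y); rewrite ?flatten_push /= -[in RHS]IH.
Qed.

Lemma cut_cons2 p x y s : cut p (x :: y :: s) =
  if p x y then [:: x] :: cut p (y :: s) else push x (cut p (y :: s)).
Proof. by []. Qed.

Lemma cut_head p x s : exists r T, cut p (x :: s) = (x :: r) :: T.
Proof.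
case: s => [|y s]; first by exists [::], [::].
rewrite cut_cons2; case: (p x y); first by exists [::], (cut p (y :: s)).
by case: (cut p (y :: s)) => [|r T]; [exists [::], [::] | exists r, T].
Qed.

Lemma has_cut p q s : has (has q) (cut p s) = has q s.
Proof.
rewrite -[in RHS](cut_flatten p s).
by elim: (cut p s) => //= r T ->; rewrite has_cat.
Qed.

Lemma le_sorted_cons2 x y s : sorted <=%O (x :: y :: s) ->
  [/\ x <= y, sorted <=%O (y :: s) & {in y :: s, forall z, y <= z}].
Proof.
move=> /= /andP[xy ys]; split=> // z; rewrite inE => /orP[/eqP->//|zs].
exact: (allP (order_path_min le_trans ys)).
Qed.

(* Equality of tableaux depends only on the row breaks between letters with no
   other letter in between. *)
Definition between s x y :=
  [&& x \in s, y \in s, x < y & all (fun z => (z <= x) || (y <= z)) s].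

Lemma eq_cut p q s : sorted <=%O s -> (forall x, p x x = false) ->
  (forall x, q x x = false) ->
  (forall x y, between s x y -> p x y = q x y) -> cut p s = cut q s.
Proof.
move=> ss p0 q0; elim: s ss => [//|x [//|y s] IH] ss pq.
have [xy ys ymin] := le_sorted_cons2 ss.
rewrite !cut_cons2 IH //; last first.
  move=> b c /and4P[bs cs bc h]; apply: pq; apply/and4P; split=> //.
  - by rewrite inE bs orbT.
  - by rewrite inE cs orbT.
  by rewrite /= (le_trans xy (ymin b bs)).
suff -> : p x y = q x y by [].
move: xy; rewrite le_eqVlt => /orP[/eqP->|xy]; first by rewrite p0 q0.
apply: pq; rewrite /between !inE !eqxx orbT xy /= lexx lexx orbT /=.
by apply/allP=> z zs; rewrite ymin ?orbT // inE zs orbT.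
Qed.

Lemma cut_inj p q s : sorted <=%O s -> cut p s = cut q s ->
  forall x y, between s x y -> p x y = q x y.
Proof.
elim: s => [//|x [|y s] IH] ss.
  by move=> _ b c; rewrite /between !inE => /and4P[/eqP-> /eqP->]; rewrite ltxx.
have [xy ys ymin] := le_sorted_cons2 ss.
rewrite !cut_cons2 => E.
have [[pq E1] b c] : (p x y = q x y) * (cut p (y :: s) = cut q (y :: s)).
  have [r [T Ep]] := cut_head p y s; have [r' [T' Eq]] := cut_head q y s.
  move: E; rewrite Ep Eq; case: (p x y); case: (q x y) => //=.
    by case=> -> ->.
  by case=> -> ->.
case/and4P=> bs cs bc h.
have cys : c \in y :: s.
  move: cs; rewrite inE => /orP[/eqP cx|//].
  move: bs; rewrite inE => /orP[/eqP bx|/ymin yb].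
    by move: bc; rewrite bx cx ltxx.
  by move: bc; rewrite cx ltNge (le_trans xy yb).
move: h => /= /andP[_ h].
have [bys|nb] := boolP (b \in y :: s).
  by apply: (IH ys E1); rewrite /between bys cys bc /=.
have bx : b = x by move: bs; rewrite inE (negbTE nb) orbF => /eqP.
suff -> : c = y by rewrite bx.
case/andP: h => /orP[yb|cy] _; last by apply/eqP; rewrite eq_le cy ymin.
by move: nb; rewrite inE bx (@eq_le _ _ x) xy -bx yb.
Qed.

Lemma kt_insert_push x T a : has (has (fun y => y <= a)) T -> x <= a ->
  kt_insert (push x T) a = push x (kt_insert T a).
Proof.
case: T => [//|r T] /= + xa.
by case: ifP => //= _; rewrite orbF xa => -> /=; rewrite ltNge xa.
Qed.

Lemma kt_insert_push0 x T a : has (has (fun y => y <= a)) T = false -> x <= a ->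
  ~~ has (@nilp A) T -> kt_insert (push x T) a = [:: x; a] :: T.
Proof.
move=> + xa; case: T => [_ _|r T] /=; first by rewrite xa /= ltNge xa.
move=> /norP[ra /negbTE->] /norP[r0 _]; rewrite xa /= ltNge xa /=.
have -> : [seq y <- r | y <= a] = [::].
  by apply/eqP; rewrite -[_ == _]negbK -has_filter.
have -> : [seq y <- r | a < y] = r.
  by apply/all_filterP/allP=> y yr; rewrite ltNge (hasPn ra).
by rewrite (negbTE r0).
Qed.

Lemma cut_nonnil p s : ~~ has (@nilp A) (cut p s).
Proof.
elim: s => [//|x [//|y s] IH]; rewrite cut_cons2.
case: (p x y); first by rewrite /= (negbTE IH).
by move: IH; case: (cut p (y :: s)) => //= r T /norP[].
Qed.

Lemma kt_insert_cut p q a s1 s2 :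
    all (fun y => y <= a) s1 -> all (fun y => a < y) s2 ->
    (forall x y, x \in s1 -> y \in s1 -> p x y = q x y) ->
    (forall x y, x \in s2 -> y \in s2 -> p x y = q x y) ->
    (if s1 is x :: s then ~~ q (last x s) a else true) ->
    (if s2 is y :: _ then q a y else true) ->
  kt_insert (cut p (s1 ++ s2)) a = cut q (s1 ++ a :: s2).
Proof.
move=> + s2a + pq2 + qa.
have no2 : has (has (fun y => y <= a)) (cut p s2) = false.
  by rewrite has_cut; apply/hasPn=> y /(allP s2a); rewrite ltNge.
have cuta : cut q (a :: s2) = [:: a] :: cut p s2.
  have -> : cut p s2 = cut q s2.
    elim: s2 {s2a no2 qa} pq2 => [//|x [//|y s] IH] h; rewrite !cut_cons2 IH.
      by rewrite (h x y) // !inE eqxx ?orbT.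
    by move=> b c bs cs; apply: h; rewrite inE ?bs ?cs orbT.
  by case: s2 qa {s2a pq2 no2} => [//|y s] qa; rewrite cut_cons2 qa.
elim: s1 => [_ _ _|x [|y s1] IH].
- by rewrite !cat0s cuta; case: (cut p s2) no2 => //= r T /norP[/negbTE-> /negbTE->].
- move=> /andP[xa _] _ /negbTE qx; rewrite !cat1s (cut_cons2 q) qx cuta /=.
  have pushE := kt_insert_push0 no2 xa (cut_nonnil p s2).
  case: (s2) no2 pushE => [//|y s] no2 pushE; case: (p x y) => //.
  by rewrite /= no2 xa /= ltNge xa.
move=> /andP[xa s1a] pq1 qx; rewrite !cat_cons !cut_cons2 -!cat_cons.
rewrite -IH //; last by move=> b c bs cs; apply: pq1; rewrite inE ?bs ?cs orbT.
have hy : has (has (fun y => y <= a)) (cut p ((y :: s1) ++ s2)).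
  by rewrite has_cut /=; case/andP: s1a => ->.
rewrite -(pq1 x y) ?inE ?eqxx ?orbT //.
by case: (p x y); [rewrite /= hy | exact: kt_insert_push].
Qed.

Lemma inversion_rcons u a x y : inversion (rcons u a) x y =
  inversion u x y || [&& x < y, x == a & y \in u].
Proof.
rewrite /inversion -andb_orr; case: (ltP x y) => //= xy.
elim: u => [|z u IH] /=.
  by rewrite andbF; case: (y == a).
rewrite inE; have [->|zy] /= := eqVneq y z; last exact: IH.
by rewrite !sub1seq mem_rcons inE orbC andbT.
Qed.

Lemma inversion_mem u x y : inversion u x y -> (x \in u) && (y \in u).
Proof. by case/andP=> _ /mem_subseq h; rewrite !h ?inE ?eqxx ?orbT. Qed.

Lemma P_hypoE u : P_hypo u = cut (inversion u) (sort <=%O u).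
Proof.
elim/last_ind: u => [//|u a IH].
rewrite /P_hypo foldl_rcons -/(P_hypo u) IH.
set s := sort <=%O u; have ss : sorted <=%O s by apply: sort_sorted le_total _.
pose s1 := [seq y <- s | y <= a]; pose s2 := [seq y <- s | a < y].
have s1a : all (fun y => y <= a) s1 by apply: filter_all.
have s2a : all (fun y => a < y) s2 by apply: filter_all.
have ss1 : sorted <=%O s1 by apply: sorted_filter => //; apply: le_trans.
have ss2 : sorted <=%O s2 by apply: sorted_filter => //; apply: le_trans.
have ps : perm_eq (s1 ++ s2) s.
  rewrite perm_sym -(perm_filterC (fun y => y <= a) s) perm_cat2l.
  by rewrite (@eq_filter _ _ (fun y => a < y)) // => y /=; rewrite ltNge.
have s12 t : sorted <=%O t -> all (fun y => a <= y) t -> sorted <=%O (s1 ++ t).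
  rewrite !sorted_pairwise; [|exact: le_trans..] => st ta.
  rewrite pairwise_cat st -sorted_pairwise ?ss1 ?andbT; last exact: le_trans.
  by apply/allrelP=> x y /(allP s1a) xa /(allP ta); apply: le_trans.
have sE : s = s1 ++ s2.
  apply: (sorted_eq le_trans le_anti ss); last by rewrite perm_sym.
  by apply: s12 => //; apply: sub_all s2a => y /ltW.
have sEa : sort <=%O (rcons u a) = s1 ++ a :: s2.
  apply: (sorted_eq le_trans le_anti (sort_sorted le_total _)).
    apply: s12; last by rewrite /= lexx; apply: sub_all s2a => y /ltW.
    rewrite /= path_min_sorted //; apply: sub_all s2a => y /ltW //.
  rewrite (perm_trans (permEl (perm_sort _ _))) //.
  rewrite perm_rcons perm_sym -cat1s perm_catCA perm_cons.
  by rewrite (perm_trans ps) // (permEl (perm_sort _ _)).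
rewrite sEa sE; apply: kt_insert_cut => //.
- move=> x y _ /(allP s1a) ya; rewrite inversion_rcons.
  case: (ltP x y) => [xy|_]; last by rewrite orbF.
  by rewrite (lt_eqF (lt_le_trans xy ya)) orbF.
- by move=> x y /(allP s2a) ax _; rewrite inversion_rcons (gt_eqF ax) andbF orbF.
- have : a \in s -> a \in s1 by rewrite mem_filter lexx.
  case: (s1) ss1 => [//|x t] st as1; rewrite inversion_rcons.
  apply/norP; split; last by apply/negP=> /and3P[h /eqP e _]; rewrite e ltxx in h.
  apply/negP=> /[dup] /inversion_mem /andP[_]; rewrite -(mem_sort <=%O) => /as1.
  move: st; rewrite lastI sorted_pairwise ?pairwise_rcons; last exact: le_trans.
  case/andP=> xa _; rewrite mem_rcons inE => /orP[/eqP<-|/(allP xa) az].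
    by rewrite /inversion ltxx.
  by rewrite /inversion ltNge az.
- case: (s2) s2a sE => [//|y t] /andP[ay _] sE.
  by rewrite inversion_rcons ay eqxx -(mem_sort <=%O) -/s sE mem_cat inE eqxx !orbT.
Qed.

Lemma P_hypo_catr u v w : P_hypo u = P_hypo v -> P_hypo (u ++ w) = P_hypo (v ++ w).
Proof. by rewrite /P_hypo !foldl_cat => ->. Qed.

Lemma inversion_cat u v x y : inversion (u ++ v) x y =
  [|| inversion u x y, inversion v x y | [&& x < y, x \in v & y \in u]].
Proof.
elim/last_ind: v => [|v a IH]; first by rewrite cats0 /inversion !andbF !orbF.
rewrite -rcons_cat !inversion_rcons IH mem_cat mem_rcons inE.
by case: (x == a); case: (x < y); case: (x \in v); case: (y \in u);
  case: (y \in v); case: (inversion u x y); case: (inversion v x y).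
Qed.

Lemma P_hypo_catl u v w : P_hypo u = P_hypo v -> P_hypo (w ++ u) = P_hypo (w ++ v).
Proof.
rewrite !P_hypoE => E.
have suv : sort <=%O u = sort <=%O v.
  by have := congr1 flatten E; rewrite !cut_flatten.
have uv : perm_eq u v by rewrite -(perm_sort <=%O) suv perm_sort.
have -> : sort <=%O (w ++ v) = sort <=%O (w ++ u).
  by apply/esym/perm_sort_leP; rewrite perm_cat2l.
have Iuv := cut_inj (sort_sorted le_total _) (etrans E (congr1 _ (esym suv))).
have bt s t x y : between (sort <=%O (s ++ t)) x y -> x \in t -> y \in t ->
    between (sort <=%O t) x y.
  case/and4P=> _ _ xy h xt yt; rewrite /between !mem_sort xt yt xy /=.
  by apply/allP=> z; rewrite mem_sort => zt; apply: (allP h); rewrite mem_sort mem_cat zt orbT.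
have irr t x : inversion t x x = false by rewrite /inversion ltxx.
apply: eq_cut => // x y /bt buv.
rewrite !inversion_cat !(perm_mem uv); congr [|| _, _ | _].
have [/andP[xu yu]|nxy] := boolP ((x \in u) && (y \in u)).
  exact: Iuv (buv xu yu).
have nxy' : ~~ ((x \in v) && (y \in v)) by rewrite -!(perm_mem uv).
by rewrite (contraNF (@inversion_mem u x y) nxy) (contraNF (@inversion_mem v x y) nxy').
Qed.

Lemma quasi_ribbon_cut (p : A -> A -> bool) s : sorted <=%O s ->
  (forall x y, p x y -> x < y) -> quasi_ribbon (cut p s).
Proof.
move=> + pP; elim: s => [//|x [//|y s] IH] /le_sorted_cons2[xy /IH {}IH _].
rewrite cut_cons2; have [r [T E]] := cut_head p y s; rewrite E in IH *.
case/andP: IH => /= /andP[yr aT] TT; rewrite /quasi_ribbon.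
case: ifP => [/pP xy'|_] /=; first by rewrite yr aT TT /row_above /= xy'.
by rewrite xy yr aT; case: T TT {E aT}.
Qed.

Lemma quasi_ribbon_P_hypo u : quasi_ribbon (P_hypo u).
Proof. by rewrite P_hypoE quasi_ribbon_cut // => x y /andP[]. Qed.

Lemma hypo_eq_refl : reflexive hypo_eq. Proof. by move=> u; apply/eqP. Qed.
Lemma hypo_eq_sym : symmetric hypo_eq.
Proof. by move=> u v; apply: eq_sym. Qed.
Lemma hypo_eq_trans : transitive hypo_eq.
Proof. by move=> v u w /eqP uv /eqP vw; apply/eqP/(etrans uv). Qed.

Canonical hypo_equiv := EquivRel hypo_eq hypo_eq_refl hypo_eq_sym hypo_eq_trans.

End Tableaux.

Section HypoplacticMonoid.
Local Open Scope quotient_scope.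
Local Open Scope group_scope.
Context (d : Order.disp_t) (A : orderType d).

Definition hypoplactic := {eq_quot @hypo_equiv d A}.
HB.instance Definition _ := Choice.on hypoplactic.

Definition hypo_class (u : seq A) : hypoplactic := \pi_({eq_quot @hypo_equiv d A}) u.
Definition hypo_one := hypo_class [::].
Definition hypo_mul (x y : hypoplactic) :=
  hypo_class (repr (x : {eq_quot @hypo_equiv d A}) ++
              repr (y : {eq_quot @hypo_equiv d A})).

Lemma hypo_classP u v : hypo_class u = hypo_class v <-> P_hypo u = P_hypo v.
Proof. by split=> [/eqmodP/eqP|/eqP uv]; last exact/eqmodP. Qed.

Lemma hypo_class_surj x : exists u, x = hypo_class u.
Proof. by exists (repr (x : {eq_quot @hypo_equiv d A})); rewrite /hypo_class reprK. Qed.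

Lemma hypo_class_cat u v : hypo_class (u ++ v) = hypo_mul (hypo_class u) (hypo_class v).
Proof.
apply/hypo_classP; set u' := repr _; set v' := repr _.
have uu' : P_hypo u = P_hypo u' by apply/hypo_classP; rewrite /u' {2}/hypo_class reprK.
have vv' : P_hypo v = P_hypo v' by apply/hypo_classP; rewrite /v' {2}/hypo_class reprK.
by rewrite (P_hypo_catr v uu') (P_hypo_catl u' vv').
Qed.

Lemma hypo_mulA : associative hypo_mul.
Proof.
move=> x y z; have [u ->] := hypo_class_surj x; have [v ->] := hypo_class_surj y.
by have [w ->] := hypo_class_surj z; rewrite -!hypo_class_cat catA.
Qed.

Lemma hypo_mul1 : left_id hypo_one hypo_mul.
Proof. by move=> x; have [u ->] := hypo_class_surj x; rewrite -hypo_class_cat. Qed.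

Lemma hypo_mulr1 : right_id hypo_one hypo_mul.
Proof.
by move=> x; have [u ->] := hypo_class_surj x; rewrite -hypo_class_cat cats0.
Qed.

HB.instance Definition _ :=
  isMonoid.Build hypoplactic hypo_mulA hypo_mul1 hypo_mulr1.

End HypoplacticMonoid.

Definition letter := {n : nat | (0 < n)%N}.
HB.instance Definition _ := SubChoice.on letter.
HB.instance Definition _ :=
  [SubChoice_isSubOrder of letter by <: with Order.NatOrder.nat_display].

Definition hypo : monoidType := hypoplactic letter.

Section DirectProduct.
Local Open Scope group_scope.
Context (I : Type) (M : I -> monoidType).

Definition dprod_one : forall i, M i := fun i => 1.
Definition dprod_mul (x y : forall i, M i) : forall i, M i := fun i => x i * y i.

Lemma dprod_mulA : associative dprod_mul.
Proof. by move=> x y z; apply: functional_extensionality_dep => i; apply: mulgA. Qed.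

Lemma dprod_mul1 : left_id dprod_one dprod_mul.
Proof. by move=> x; apply: functional_extensionality_dep => i; apply: mul1g. Qed.

Lemma dprod_mulr1 : right_id dprod_one dprod_mul.
Proof. by move=> x; apply: functional_extensionality_dep => i; apply: mulg1. Qed.

HB.instance Definition _ :=
  isMonoid.Build (forall i, M i) dprod_mulA dprod_mul1 dprod_mulr1.

End DirectProduct.

(* Every type has a choice structure (boolp), so that quantifying over
   [monoidType] is quantifying over all monoids. The types in [subMonoidType S]
   are the types in bijection, by a morphism [val], with the submonoid [S]. *)
Record is_variety (V : monoidType -> Prop) : Prop := IsVariety {
  variety_image : forall (M N : monoidType) (f : M -> N),
    monoid_morphism f -> (forall y, exists x, f x = y) -> V M -> V N;
  variety_sub : forall (M : monoidType) (S : pred M) (N : subMonoidType S),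
    V M -> V N;
  variety_prod : forall (I : Type) (M : I -> monoidType),
    (forall i, V (M i)) -> V (forall i, M i)
}.

Definition variety_of (M N : monoidType) : Prop :=
  forall V, is_variety V -> V M -> V N.

Definition generates (M : monoidType) (V : monoidType -> Prop) : Prop :=
  forall N, V N <-> variety_of M N.

Definition is_free (V : monoidType -> Prop) (X : Type) (F : monoidType)
    (i : X -> F) : Prop :=
  V F /\ forall (M : monoidType) (f : X -> M), V M ->
    exists g : F -> M, [/\ monoid_morphism g, (forall x, g (i x) = f x) &
      forall h : F -> M, monoid_morphism h -> (forall x, h (i x) = f x) -> h =1 g].

(* [V] is generated by the [V]-free monoid over an alphabet with [r] letters. *)
Definition generated_by_free (V : monoidType -> Prop) (r : nat) : Prop :=
  exists (F : monoidType) (i : 'I_r -> F), is_free V i /\ generates F V.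

Definition basis_rank (V : monoidType -> Prop) (r : nat) : Prop :=
  generated_by_free V r /\ forall s, generated_by_free V s -> (r <= s)%N.

(* Main.v *)
From HB Require Import structures.
From mathcomp Require Import all_boot all_order boolp.
Require Import Defs.

Set Implicit Arguments.
Unset Strict Implicit.
Unset Printing Implicit Defensive.

Import Order.TTheory.

(* The V-free monoid over X is the submonoid of the power hypo ^ (X -> hypo)
   generated by the coordinate functions, since every member of V satisfies the
   identities of hypo. By Novelli's description, the hypoplactic class of a word
   is determined by the classes of the subwords on each pair of letters; hence
   hypo is a quotient of a submonoid of a power of the free monoid of rank 2. A
   free monoid of rank at most 1 is commutative, and hypo is not. *)

Section Tableaux.
Local Open Scope order_scope.
Context (d : Order.disp_t) (A : orderType d).
Implicit Types (x y : A) (u v : seq A).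

(** Novelli's description, as [between u x y] makes [x < y] consecutive in the support of [u]:
    concatenating the rows of a tableau recovers the content, and its row breaks record the
    inversions. *)
Lemma eq_P_hypo u v : P_hypo u = P_hypo v <-> perm_eq u v /\
  forall x y, between u x y -> inversion u x y = inversion v x y.
Proof.
have btE x y : between (sort <=%O u) x y = between u x y.
  rewrite /between !mem_sort; congr [&& _, _, _ & _].
  exact/perm_all/permEl/perm_sort.
have ss : sorted <=%O (sort <=%O u) by apply: sort_sorted le_total _.
rewrite !P_hypoE; split=> [E|[/perm_sort_leP <- inv]]; last first.
  by apply: eq_cut => // [x|x|x y]; rewrite ?btE /inversion ?ltxx //; apply: inv.
have suv : sort <=%O u = sort <=%O v.
  by have := congr1 flatten E; rewrite !cut_flatten.
split=> [|x y]; first exact/perm_sort_leP.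
by rewrite -btE; apply: cut_inj => //; rewrite E suv.
Qed.

(** Letters consecutive in the support of [u] stay so in the subword on these two letters, which
    keeps their inversion if there is one. *)
Lemma eq_P_hypo_pairs u v :
  (forall x y, P_hypo (filter (pred2 x y) u) = P_hypo (filter (pred2 x y) v)) ->
  P_hypo u = P_hypo v.
Proof.
move=> E; apply/eq_P_hypo; split=> [|x y /and4P[xu yu xy _]].
  apply/permP=> a; apply/permP: a; apply/allP=> x _ /=; apply/eqP.
  (* The degenerate pair [x], [x] gives the multiplicity of [x]. *)
  have /eq_P_hypo[/permP/(_ (pred1 x)) + _] := E x x.
  rewrite !count_filter.
  have cE w : count (predI (pred1 x) (pred2 x x)) w = count_mem x w.
    by apply: eq_count => z /=; case: eqP.
  by rewrite !cE.
have /eq_P_hypo[_ /(_ x y)] := E x y.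
rewrite /between !mem_filter /= !eqxx orbT xu yu xy /inversion /= !subseq_filter /=.
rewrite !eqxx orbT xy /=; apply; apply/allP=> z; rewrite mem_filter.
by case/andP=> /= /orP[]/eqP-> _; rewrite lexx ?orbT.
Qed.

End Tableaux.

Local Open Scope group_scope.

Lemma monoid_morphism_prod (M N : monoidType) (f : M -> N) (fM : monoid_morphism f)
    (X : Type) (g : X -> M) (u : seq X) :
  f (\prod_(x <- u) g x) = \prod_(x <- u) f (g x).
Proof. by apply: big_morph; [exact: fM.2 | exact: fM.1]. Qed.

Lemma dprod_prodE (I X : Type) (M : I -> monoidType) (g : X -> forall i, M i)
    (u : seq X) (i : I) :
  (\prod_(x <- u) g x : forall i, M i) i = \prod_(x <- u) g x i.
Proof. by apply: (big_morph (fun y : forall i, M i => y i)). Qed.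

(** Carries an identity from a monoid to the variety it generates. Assignments lift along
    surjections, [val] is injective on submonoids, and products are compared coordinatewise. *)
Lemma is_variety_identity (X : Type) (u v : seq X) :
  is_variety (fun M => forall f : X -> M,
    \prod_(x <- u) f x = \prod_(x <- v) f x).
Proof.
split=> [M N f fM fS uv g|M S N uv g|I M uv g].
- have [h hg] := choice (fun x => fS (g x)).
  by rewrite -(funext hg : (fun x => f (h x)) = g) -!(monoid_morphism_prod fM) uv.
- have vM : monoid_morphism (val : N -> M) by split; [exact: gmulf1 | exact: gmulfM].
  by apply: val_inj; rewrite !(monoid_morphism_prod vM) uv.
- by apply: functional_extensionality_dep => i; rewrite !dprod_prodE uv.
Qed.

Section GeneratedSubmonoid.
Context (X : Type) (M : monoidType) (g : X -> M).

Definition generated : pred M :=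
  fun y => `[< exists u : seq X, y = \prod_(x <- u) g x >].

Lemma generated_closed : monoid_closed generated.
Proof.
split; first by apply/asboolP; exists [::]; rewrite big_nil.
move=> _ _ /asboolP[u ->] /asboolP[v ->]; apply/asboolP; exists (u ++ v).
by rewrite big_cat.
Qed.

Definition gen_submonoid := {y : M | generated y}.
HB.instance Definition _ := SubChoice.on gen_submonoid.
HB.instance Definition _ :=
  SubChoice_isSubMonoid.Build M generated gen_submonoid generated_closed.

Lemma generated_gen x : generated (g x).
Proof. by apply/asboolP; exists [:: x]; rewrite big_seq1. Qed.

Definition gen x : gen_submonoid := Sub (g x) (generated_gen x).

Lemma gen_val_morphism : monoid_morphism (val : gen_submonoid -> M).
Proof. by split; [exact: gmulf1 | exact: gmulfM]. Qed.

Lemma gen_surj (y : gen_submonoid) : exists u, y = \prod_(x <- u) gen x.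
Proof.
have /asboolP[u yE] := valP y; exists u; apply: val_inj.
by rewrite yE (monoid_morphism_prod gen_val_morphism).
Qed.

(** [h] evaluates under [f] a word chosen for each element; the hypothesis makes the value
    independent of the choice. *)
Lemma gen_lift (N : monoidType) (f : X -> N) :
  (forall u v, \prod_(x <- u) g x = \prod_(x <- v) g x ->
     \prod_(x <- u) f x = \prod_(x <- v) f x) ->
  exists h : gen_submonoid -> N,
    [/\ monoid_morphism h, (forall x, h (gen x) = f x) &
      forall h', monoid_morphism h' -> (forall x, h' (gen x) = f x) -> h' =1 h].
Proof.
move=> fP; have [w wE] := choice gen_surj.
pose h y := \prod_(x <- w y) f x.
have hE u : h (\prod_(x <- u) gen x) = \prod_(x <- u) f x.
  apply: fP; have /(congr1 val) := wE (\prod_(x <- u) gen x).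
  by rewrite !(monoid_morphism_prod gen_val_morphism).
exists h; split=> [|x|h' h'M h'g y].
- split; first by have := hE [::]; rewrite !big_nil.
  by move=> y z; rewrite {1}(wE y) {1}(wE z) -big_cat hE big_cat.
- by have := hE [:: x]; rewrite !big_seq1.
- rewrite (wE y) hE (monoid_morphism_prod h'M).
  by apply: eq_bigr => x _; apply: h'g.
Qed.

End GeneratedSubmonoid.

(* M is a quotient of the submonoid of the product of the N i generated by the
   families (g i x)_i. *)
Lemma variety_separation (V : monoidType -> Prop) (I X : Type)
    (N : I -> monoidType) (g : forall i, X -> N i) (M : monoidType) (f : X -> M) :
  is_variety V -> (forall i, V (N i)) ->
  (forall y, exists u, y = \prod_(x <- u) f x) ->
  (forall u v, (forall i, \prod_(x <- u) g i x = \prod_(x <- v) g i x) ->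
     \prod_(x <- u) f x = \prod_(x <- v) f x) ->
  V M.
Proof.
move=> VV VN fS fP; pose G x : forall i, N i := fun i => g i x.
have [|h [hM hg _]] := @gen_lift X _ G M f.
  move=> u v uv; apply: fP => i.
  by have /(congr1 (fun y : forall i, N i => y i)) := uv; rewrite !dprod_prodE.
apply: (variety_image VV hM).
  move=> y; have [u ->] := fS y; exists (\prod_(x <- u) gen G x).
  by rewrite (monoid_morphism_prod hM); apply: eq_bigr => x _; apply: hg.
exact: (variety_sub VV) (variety_prod VV VN).
Qed.

Lemma is_variety_variety_of (M : monoidType) : is_variety (variety_of M).
Proof.
split=> [N N' f fM fS VN|N S N' VN|I N VN] V VV VM.
- exact: (variety_image VV fM fS (VN V VV VM)).
- exact: (variety_sub VV N' (VN V VV VM)).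
- by apply: (variety_prod VV) => i; apply: VN.
Qed.

Section FreeMonoid.
Context (M : monoidType) (X : Type).

(** The power of [M] is indexed by all assignments, so two words agree on the coordinates exactly
    when they form an identity of [M]. *)
Definition coordinate (x : X) : forall f : X -> M, M := fun f => f x.

Definition free_monoid := gen_submonoid coordinate.

Lemma free_monoid_is_free :
  is_free (variety_of M) (gen coordinate : X -> free_monoid).
Proof.
split.
  move=> V VV VM; apply: (variety_sub VV).
  by apply: (variety_prod VV) => _.
move=> N f VN; apply: gen_lift => u v uv.
apply: (VN _ (is_variety_identity u v)) => h.
by have /(congr1 (fun y => y h)) := uv; rewrite !dprod_prodE.
Qed.

End FreeMonoid.

(** The free monoid maps to its submonoid generated by [i]; followed by the inclusion, this fixes
    each [i x], so by uniqueness it is the identity. *)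
Lemma free_surj (V : monoidType -> Prop) (X : Type) (F : monoidType) (i : X -> F) :
  is_variety V -> is_free V i -> forall y, exists u, y = \prod_(x <- u) i x.
Proof.
move=> VV [VF Fi] y.
have [h [hM hi _]] := Fi (gen_submonoid i) (gen i) (variety_sub VV (gen_submonoid i) VF).
have [k [_ _ ku]] := Fi F i VF.
have vM := gen_val_morphism i.
have -> : y = val (h y).
  rewrite (ku (fun z => val (h z))); first by apply: (ku id).
    by split=> [|a b]; rewrite ?hM.1 ?hM.2 ?vM.1 ?vM.2.
  by move=> x; rewrite hi.
by have /asboolP := valP (h y).
Qed.

Lemma free_commutative (V : monoidType -> Prop) (s : nat) (F : monoidType)
    (i : 'I_s -> F) :
  is_variety V -> is_free V i -> (s < 2)%N -> forall x y : F, x * y = y * x.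
Proof.
move=> VV Fi s2 x y.
have [u ->] := free_surj VV Fi x; have [v ->] := free_surj VV Fi y.
have ord_eq (a b : 'I_s) : a = b.
  have val0 (c : 'I_s) : c = 0 :> nat.
    by apply/eqP; rewrite -leqn0 -ltnS (leq_trans (ltn_ord c)).
  by apply: ord_inj; rewrite !val0.
apply: commute_prod => a _; apply: commute_sym; apply: commute_prod => b _.
by rewrite (ord_eq a b).
Qed.

Lemma hypo_class_prod (u : seq letter) :
  hypo_class u = \prod_(a <- u) (hypo_class [:: a] : hypo).
Proof.
elim: u => [|a u IH]; first by rewrite big_nil.
by rewrite big_cons -IH -cat1s hypo_class_cat.
Qed.

(** The tableau of 12 is a single row, that of 21 a single column. *)
Lemma hypo_noncommutative : ~ forall x y : hypo, x * y = y * x.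
Proof.
pose a : letter := exist _ 1%N isT; pose b : letter := exist _ 2%N isT.
move=> /(_ (hypo_class [:: a]) (hypo_class [:: b])).
by rewrite -[LHS]hypo_class_cat -[RHS]hypo_class_cat => /hypo_classP.
Qed.

Lemma variety_of_free2_hypo : variety_of (free_monoid hypo 'I_2) hypo.
Proof.
move=> V VV VF; set F := free_monoid hypo 'I_2 in VF.
pose e (k : 'I_2) : F := gen (@coordinate hypo 'I_2) k.
(* Each pair of letters gives a map onto the two free generators that erases all other letters. *)
pose g (ab : letter * letter) c : F :=
  if c == ab.1 then e ord0 else if c == ab.2 then e ord_max else 1.
apply: (variety_separation (g := g) (f := fun a => hypo_class [:: a] : hypo)) => //.
  by move=> y; have [u ->] := hypo_class_surj y; exists u; apply: hypo_class_prod.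
move=> u v uv; rewrite -!hypo_class_prod; apply/hypo_classP.
apply: eq_P_hypo_pairs => a b; apply/hypo_classP.
(* Sending the generators back to [a] and [b] recovers the class of the subword on these letters. *)
pose f (k : 'I_2) : hypo := hypo_class [:: if k == ord0 then a else b].
have [h [hM he _]] := (free_monoid_is_free hypo 'I_2).2 hypo f (fun _ _ => id).
have hE w : h (\prod_(c <- w) g (a, b) c) = hypo_class (filter (pred2 a b) w).
  rewrite (monoid_morphism_prod hM) hypo_class_prod big_filter [RHS]big_mkcond /=.
  apply: eq_bigr => c _; rewrite /g /=.
  have [->|_] := eqVneq c a; first exact: he.
  by have [->|_] := eqVneq c b; [exact: he | exact: hM.1].
by rewrite -!hE uv.
Qed.

Theorem proposition3p8 : basis_rank (variety_of hypo) 2.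
Proof.
have hypoV : is_variety (variety_of hypo) := is_variety_variety_of hypo.
split=> [|s [F [i [Fi Fgen]]]].
  have free := free_monoid_is_free hypo 'I_2.
  exists (free_monoid hypo 'I_2), (gen _); split=> // N; split=> VN V VV VM.
    exact: VN VV (variety_of_free2_hypo VV VM).
  exact: VN VV (free.1 V VV VM).
rewrite leqNgt; apply/negP=> /(free_commutative hypoV Fi) Fcom.
apply: hypo_noncommutative => x y.
(* Commutativity, as an identity in two variables indexed by [bool], would pass from [F] to
   [hypo]. *)
have /Fgen/(_ _ (is_variety_identity [:: false; true] [:: true; false])) :
  variety_of hypo hypo by move=> V.
move=> /(_ _ (fun k : bool => if k then y else x)).
rewrite !big_cons !big_nil !mulg1; apply=> f.
by rewrite !big_cons !big_nil !mulg1.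
Qed.
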